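(* For integers $n\ge1$ and $0\le k\le n$, there exists a UOBDD $M_n$ of width $\max\{k+1,n-k+1\}$ that computes $\mathtt{EXACT}^k_n$ exactly (and hence also computes it as an NUOBDD).
   Context: $\mathtt{EXACT}^k_n:\{0,1\}^n\to\{0,1\}$ is $1$ iff the input contains exactly $k$ ones. A unitary OBDD (UOBDD) of width $d$ on $n$ variables is $(Q,|\psi^0\rangle,T,Q_{acc})$: $Q=\{q_1,\dots,q_d\}$ indexes an orthonormal basis of $\mathbb{C}^d$, $|\psi^0\rangle$ a unit vector, $Q_{acc}\subseteq Q$, $T=((i_j,U_j(0),U_j(1)))_{j=1}^n$ with $(i_1,\dots,i_n)$ a permutation of $\{1,\dots,n\}$ and $U_j(b)$ unitary $d\times d$ matrices. On input $\sigma$ the final state is $|\psi^n\rangle=U_n(\sigma_{i_n})\cdots U_1(\sigma_{i_1})|\psi^0\rangle$ and the acceptance probability is $\|P_{acc}|\psi^n\rangle\|^2$ with $P_{acc}$ the projection onto the span of accepting basis states. A UOBDD computes $f$ exactly if its acceptance probability on every $\sigma$ equals $f(\sigma)\in\{0,1\}$. An NUOBDD computes $f$ if for all $\sigma$: $f(\sigma)=1$ iff the acceptance probability is nonzero. *)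

(* Defs.v *)
From mathcomp Require Import all_boot all_order all_fingroup all_algebra.
From mathcomp Require Import reals.
From mathcomp.real_closed Require Import complex.

Set Implicit Arguments.
Unset Strict Implicit.
Unset Printing Implicit Defensive.

Import GRing.Theory Num.Theory.
Local Open Scope ring_scope.

Definition boolfun (n : nat) := n.-tuple bool -> bool.

Definition EXACT (n k : nat) : boolfun n := fun s => count_mem true s == k.

Definition l2norm (R : realType) (d : nat) (v : 'cV[R[i]]_d) : R :=
  Num.sqrt (\sum_(q < d) Normc.normc (v q 0) ^+ 2).

(* The basis state |q_(i+1)> is the i-th standard basis vector of C^d, i : 'I_d.
   Position j (counted from 0) of the program reads the variable [var_order j]
   and applies [trans j b], b being the value read. *)
Record UOBDD (R : realType) (d n : nat) := MkUOBDD {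
  psi0 : 'cV[R[i]]_d;
  psi0_unit : l2norm psi0 = 1;
  var_order : {perm 'I_n};
  trans : 'I_n -> bool -> 'M[R[i]]_d;
  trans_unitary : forall (j : 'I_n) (b : bool), trans j b \is unitarymx;
  acc : {set 'I_d}
}.

Definition final_state (R : realType) (d n : nat) (M : UOBDD R d n)
    (s : n.-tuple bool) : 'cV[R[i]]_d :=
  foldl (fun psi j => trans M j (tnth s (var_order M j)) *m psi)
        (psi0 M) (enum 'I_n).

Definition proj_acc (R : realType) (d n : nat) (M : UOBDD R d n) :
    'M[R[i]]_d :=
  \sum_(q in acc M) delta_mx q q.

Definition acc_prob (R : realType) (d n : nat) (M : UOBDD R d n)
    (s : n.-tuple bool) : R :=
  l2norm (proj_acc M *m final_state M s) ^+ 2.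

Definition computes_exactly (R : realType) (d n : nat) (M : UOBDD R d n)
    (f : boolfun n) : Prop :=
  forall s : n.-tuple bool, acc_prob M s = (f s)%:R.

Definition computes_nondet (R : realType) (d n : nat) (M : UOBDD R d n)
    (f : boolfun n) : Prop :=
  forall s : n.-tuple bool, f s = true <-> acc_prob M s <> 0.

(* Main.v *)
(* Count the ones modulo [d = max(k+1, n-k+1)] by a cyclic shift of the basis
   states.  A count [c <= n] congruent to [k] modulo [d] equals [k], because
   [k - d < 0] and [k + d > n]; so accepting on the residue [k] is exact. *)
Require Import Defs.
From mathcomp Require Import all_boot all_order all_fingroup all_algebra.
From mathcomp Require Import reals.
From mathcomp.real_closed Require Import complex.
From mathcomp Require Import zify.

Set Implicit Arguments.
Unset Strict Implicit.
Unset Printing Implicit Defensive.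

Import GRing.Theory Num.Theory.
Local Open Scope ring_scope.

Lemma perm_mx_unitary (C : numClosedFieldType) (d : nat) (s : {perm 'I_d}) :
  (perm_mx s : 'M[C]_d) \is unitarymx.
Proof.
by apply/unitarymxP; rewrite tr_perm_mx map_perm_mx -perm_mxM mulgV perm_mx1.
Qed.

(** Row [a] of [perm_mx s *m v] is row [s a] of [v], whence the inverse. *)
Lemma perm_mx_delta (A : nzRingType) (d : nat) (s : {perm 'I_d}) (i : 'I_d) :
  perm_mx s *m delta_mx i 0 = delta_mx ((s^-1)%g i) 0 :> 'cV[A]_d.
Proof.
rewrite -row_permE; apply/matrixP=> a b; rewrite !mxE.
by rewrite (can2_eq (permK s) (permKV s)).
Qed.

Lemma l2norm_delta (R : realType) (d : nat) (i : 'I_d) :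
  l2norm (delta_mx i 0 : 'cV[R[i]]_d) = 1.
Proof.
rewrite /l2norm (bigD1 i) //= mxE !eqxx big1 => [|j /negPf ne_ji].
  by rewrite addr0 Normc.normc1 expr1n sqrtr1.
by rewrite mxE ne_ji Normc.normc0 expr0n.
Qed.

Lemma proj_acc_delta (R : realType) (d n : nat) (M : UOBDD R d n) (i : 'I_d) :
  proj_acc M *m delta_mx i 0 = (i \in acc M)%:R *: delta_mx i 0 :> 'cV_d.
Proof.
rewrite /proj_acc mulmx_suml.
have [iA | iNA] := boolP (i \in acc M).
  rewrite (bigD1 i) //= mul_delta_mx scale1r big1 ?addr0 // => j /andP[_ ne_ji].
  by rewrite mul_delta_mx_0.
rewrite scale0r big1 // => j jA; rewrite mul_delta_mx_0 //.
by apply: contraNneq iNA => <-.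
Qed.

(** The projection either fixes a basis state or kills it, so a run that ends in one has acceptance
    probability 0 or 1. *)
Lemma acc_prob_delta (R : realType) (d n : nat) (M : UOBDD R d n) s (i : 'I_d) :
  final_state M s = delta_mx i 0 -> acc_prob M s = (i \in acc M)%:R.
Proof.
rewrite /acc_prob => ->; rewrite proj_acc_delta.
case: (i \in acc M); first by rewrite scale1r l2norm_delta expr1n.
rewrite scale0r /l2norm big1 ?sqrtr0 ?expr0n // => j _.
by rewrite mxE Normc.normc0 expr0n.
Qed.

(** The inverse cancels the one in [perm_mx_delta], so that reading a one moves state [i] to
    [ordS i]. The identity is written as [perm_mx 1] so that both cases are permutation matrices. *)
Definition cyclic_trans (R : realType) (d : nat) (b : bool) : 'M[R[i]]_d :=
  if b then perm_mx (perm (can_inj (@ordSK d)))^-1%g else perm_mx 1%g.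

Lemma cyclic_trans_unitary (R : realType) (d : nat) b :
  cyclic_trans R d b \is unitarymx.
Proof. by case: b; apply: perm_mx_unitary. Qed.

Definition cyclic_UOBDD (R : realType) (d n : nat) (A : {set 'I_d.+1}) :
    UOBDD R d.+1 n :=
  MkUOBDD (l2norm_delta R ord0) 1%g
    (fun _ : 'I_n => cyclic_trans_unitary R d.+1) A.

(** The starting count [c] is arbitrary because each step of a left fold changes the initial
    state. *)
Lemma cyclic_trans_foldl (R : realType) (d : nat) (s : seq bool) (c : nat) :
  foldl (fun psi b => cyclic_trans R d.+1 b *m psi)
    (delta_mx (inZp c) 0) s
    = delta_mx (inZp (c + count_mem true s)) 0 :> 'cV_d.+1.
Proof.
elim: s c => [|b s IHs] c /=; first by rewrite addn0.
rewrite addnA -IHs; congr foldl.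
case: b; rewrite perm_mx_delta; last by rewrite invg1 perm1 addn0.
rewrite invgK; congr delta_mx; rewrite permE; apply: val_inj.
by rewrite /= -addn1 modnDml addn1.
Qed.

Lemma final_state_cyclic (R : realType) (d n : nat) (A : {set 'I_d.+1}) (s : n.-tuple bool) :
  final_state (cyclic_UOBDD R n A) s
    = delta_mx (inZp (count_mem true s)) 0.
Proof.
(* Listing the entries of [s] along [enum 'I_n] turns both sides into folds over the same indices,
   compared below from an arbitrary state. *)
rewrite -[X in inZp X]add0n -cyclic_trans_foldl -[in RHS](map_tnth_enum s).
rewrite /final_state /= (_ : ord0 = inZp 0); last exact: val_inj.
elim: (enum _) (delta_mx _ _) => //= j js IHjs psi.
by rewrite perm1 IHjs.
Qed.

Lemma eqn_mod_window (n k d c : nat) :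
  (k < d -> n < k + d -> c <= n -> (c %% d == k %% d) = (c == k))%N.
Proof.
move=> lt_kd lt_n le_cn; apply/idP/idP => [|/eqP-> //].
(* Subtraction is truncated, so the sign of [c - k] is fixed first. A positive difference divisible
   by [d] would be at least [d], against [n < k + d] in one case and [k < d] in the other. *)
have [le_kc | lt_ck] := leqP k c.
  rewrite eqn_mod_dvd //; case: (posnP (c - k)) => [|ck_gt0 /(dvdn_leq ck_gt0)]; lia.
by rewrite eq_sym eqn_mod_dvd ?(ltnW lt_ck) // => /dvdn_leq; lia.
Qed.

Lemma computes_exactly_nondet (R : realType) (d n : nat) (M : UOBDD R d n) f :
  computes_exactly M f -> computes_nondet M f.
Proof.
move=> Mf s; rewrite Mf; split=> [-> | /eqP]; first exact/eqP/oner_neq0.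
by case: (f s) => //; rewrite eqxx.
Qed.

Lemma cyclic_UOBDD_EXACT (R : realType) (n k d : nat) :
    (k < d.+1 -> n < k + d.+1 ->
    computes_exactly (cyclic_UOBDD R n [set inZp k : 'I_d.+1]) (@EXACT n k))%N.
Proof.
move=> lt_kd lt_n s; rewrite (acc_prob_delta (final_state_cyclic _ _ _)) inE.
rewrite -val_eqE /= (eqn_mod_window lt_kd lt_n) //.
by rewrite -[X in (_ <= X)%N](size_tuple s) count_size.
Qed.

Local Close Scope ring_scope.

Theorem theorem4 (R : realType) (n k : nat) (hn : 1 <= n) (hk : k <= n) :
  exists M : UOBDD R (maxn (k + 1) (n - k + 1)) n,
    computes_exactly M (@EXACT n k) /\ computes_nondet M (@EXACT n k).
Proof.
(* The type of [M] depends on the width, which must be a visible successor for [cyclic_UOBDD] to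
   apply. *)
have -> : maxn (k + 1) (n - k + 1) = (maxn k (n - k)).+1 by lia.
have exM : computes_exactly _ (@EXACT n k) :=
  @cyclic_UOBDD_EXACT R n k (maxn k (n - k)) ltac:(lia) ltac:(lia).
exact: ex_intro (conj exM (computes_exactly_nondet exM)).
Qed.
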